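(* Let $a,k,d,e$ be integers with $1\le a\le k$, $1\le d\le k$, and either $e=d$ or $2e=d$. Let ${}_d\overline{B}_{dk+e,\,da}(n)$ be the number of partitions of $n$ such that $$\phi_i+\phi_{i+1}<dk+e\ \text{ for all } i\ge1,\qquad \phi_1<da,\qquad d\mid\phi_{2i+1}\ \text{ for all } i\ge 0.$$ Then $$\sum_{n\ge0}{}_d\overline{B}_{dk+e,\,da}(n)\,q^n=\frac{(q^{da},q^{2dk-da+2e+d},q^{2dk+2e+d};q^{2dk+2e+d})_\infty}{(q^{d};q^{2d})_\infty\,(q^2;q^2)_\infty}.$$
   Context: A partition of a nonnegative integer $n$ is a finite non-increasing sequence of positive integers summing to $n$ (the empty partition is the unique partition of $0$). For a partition and an integer $i\ge1$, $\phi_i$ denotes the number of times $i$ occurs as a part. For $|q|<1$: $(a;q)_n=(1-a)(1-aq)\cdots(1-aq^{n-1})$, $(a;q)_\infty=\lim_{n\to\infty}(a;q)_n$, and $(a_1,\dots,a_r;q)_\infty=(a_1;q)_\infty\cdots(a_r;q)_\infty$. The identity is of formal power series in $q$. *)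

(* Defs.v *)
From HB Require Import structures.
From mathcomp Require Import all_boot all_order all_algebra.
Set Implicit Arguments. Unset Strict Implicit. Unset Printing Implicit Defensive.
Import GRing.Theory.
Local Open Scope ring_scope.

Definition is_partition (n : nat) (s : seq nat) : Prop :=
  sorted geq s /\ all (fun x => 0 < x)%N s /\ sumn s = n.

Definition phi (s : seq nat) (i : nat) : nat := count_mem i s.

(* Truncation at degree N of (q^a; q^c)_infty, as a polynomial over int:
   the product of the factors (1 - q^(a + c j)) with a + c j <= N.
   (The omitted factors are congruent to 1 modulo q^(N+1); for c >= 1 every
   j with a + c j <= N satisfies j <= N.) *)
Definition qpoch_tr (N a c : nat) : {poly int} :=
  \prod_(0 <= j < N.+1 | (a + c * j <= N)%N) (1 - 'X^(a + c * j)).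

(* Truncation at degree N of 1 / (q^a; q^c)_infty: product over the factors
   with a + c j <= N of the geometric series 1/(1 - q^m), m = a + c j,
   each truncated to sum_{i <= N} q^(m i). *)
Definition qpoch_inv_tr (N a c : nat) : {poly int} :=
  \prod_(0 <= j < N.+1 | (a + c * j <= N)%N)
     \sum_(0 <= i < N.+1) 'X^((a + c * j) * i).

(* Main.v *)
Require Import Defs.
From HB Require Import structures.
From mathcomp Require Import all_boot all_order all_algebra.
From mathcomp Require Import qpoly ring zify.
Set Implicit Arguments. Unset Strict Implicit. Unset Printing Implicit Defensive.
Import GRing.Theory.
Local Open Scope ring_scope.

(** Put [K = dk + e], [M = 2K + d] and [[m]_y = 1 + y + ... + y^(m-1)].  Let
    [S_i(a)] (resp. [T_i(b)]) be the generating function of the admissible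
    partitions with all parts [> 2i] and [phi_(2i+1) < da] (resp. all parts
    [> 2i+1] and [phi_(2i+2) < db + e]).  Removing the smallest part size gives,
    with [y = q^(2i+2)],
      [S_i(a+1) - S_i(a) = q^(da(2i+1)) T_i(k-a)],
      [T_i(b+1) - T_i(b) = y^(db+e) [d]_y S_(i+1)(k-b)],
      [T_i(0) = [e]_y S_(i+1)(k+1)].
    Together with [S_i(a) = 1 + O(q^(2i+1))] this system has a unique solution,
    namely [S_i(a) (q^d;q^d)_oo = F_i(a) prod_(l > i) [d]_(q^(2l))] with the series
      [F_i(a) = sum_n (-1)^n q^(2iKn + M n(n+1)/2 - dan) (1 - q^(da(2n+2i+1)))
                (q^(d(n+1));q^d)_(2i)],
    which generalises those of Andrews.  The hypothesis on [e] is what makes the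
    initial condition for [T_i(0)] hold.  At [i = 0] the series [F_0(a)] is a theta
    series, summed by Jacobi's triple product.

    Everything takes place in a commutative ring with an element [q] such that
    [q^(N+1) = 0], eventually [int[X]/(X^(N+1))], where all sums and products are
    finite. *)

(** * Inverses when [q] is nilpotent *)

Section Nilpotent.
Variables (R : comNzRingType) (q : R) (N : nat).
Hypothesis q_nil : q ^+ N.+1 = 0.

Lemma expr_nil m : (N < m)%N -> q ^+ m = 0.
Proof. by move=> Nm; rewrite -(subnK Nm) exprD q_nil mulr0. Qed.

Lemma expr_nilM m j : (0 < m)%N -> (N < j)%N -> q ^+ (m * j) = 0.
Proof. by move=> m0 Nj; apply: expr_nil; nia. Qed.

Definition ginv (x : R) : R := \sum_(0 <= i < N.+1) x ^+ i.

Lemma mul_ginv m : (0 < m)%N -> (1 - q ^+ m) * ginv (q ^+ m) = 1.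
Proof.
move=> m0; rewrite /ginv big_mkord -opprB mulNr -subrX1 -exprM expr_nilM //.
by rewrite sub0r opprK.
Qed.
End Nilpotent.

(** * Difference equations for the series *)

Section Telescope.
Variable V : zmodType.

(** For comparing two alternating series when part of each term belongs with the next index; the
    shifted part [g] vanishes at both ends. *)
Lemma telescope_shift (B : nat) (u w g h : nat -> V) :
  g 0 = 0 -> g B = 0 ->
  (forall n, u n = g n + h n) -> (forall n, w n = h n + g n.+1) ->
  \sum_(n < B) u n = \sum_(n < B) w n.
Proof.
move=> g0 gB Hu Hw.
under eq_bigr do rewrite Hu; under [RHS]eq_bigr do rewrite Hw.
rewrite !big_split /= addrC; congr (_ + _).
have: \sum_(n < B.+1) g n = \sum_(n < B.+1) g n by [].
by rewrite {1}big_ord_recr big_ord_recl /= g0 gB addr0 add0r.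
Qed.
End Telescope.

Section Difference.
Variables (R : comNzRingType) (q : R) (N d K : nat).
Hypothesis q_nil : q ^+ N.+1 = 0.
Hypothesis d_gt0 : (0 < d)%N.

Let M := (2 * K + d)%N.

Definition qprod (m n : nat) : R := \prod_(l < m) (1 - q ^+ (d * (n + l.+1))).

Definition quad (i r n : nat) : nat := (2 * i * K * n + M * 'C(n, 2) + r * n)%N.

(* With [s = da] and [r = M - s] these are the terms of [F_i(a)]; with [c = db + e]
   and [s = K - c], the [Hterm]s are those of the series that solves for [T_i(b)]. *)
Definition Fterm (i s r n : nat) : R :=
  (-1) ^+ n * q ^+ quad i r n * (1 - q ^+ (s * (2 * n + 1 + 2 * i)))
  * qprod (2 * i) n.

Definition Hterm (i c s n : nat) : R :=
  (-1) ^+ n * q ^+ quad i (M + s) n * (1 - q ^+ (c * (2 * n + 2 * i + 2)))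
  * qprod (2 * i).+1 n.

Definition Fsum i s r := \sum_(n < N.+1) Fterm i s r n.
Definition Hsum i c s := \sum_(n < N.+1) Hterm i c s n.

Lemma qprodSr m n : qprod m.+1 n = qprod m n * (1 - q ^+ (d * (n + m.+1))).
Proof. by rewrite /qprod big_ord_recr. Qed.

Lemma qprodSl m n : qprod m.+1 n = (1 - q ^+ (d * n.+1)) * qprod m n.+1.
Proof.
rewrite /qprod big_ord_recl addn1; congr (_ * _).
by apply: eq_bigr => l _; rewrite lift0 addSnnS.
Qed.

Lemma quadS i r n :
  quad i r n.+1 = (quad i r n + 2 * i * K + M * n + r)%N.
Proof. by rewrite /quad binS bin1; ring. Qed.

Lemma quad_top i r : (0 < r)%N -> q ^+ quad i r N.+1 = 0.
Proof.
move=> r0; apply: (expr_nil q_nil); rewrite /quad.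
by apply: leq_trans (leq_addl _ _); rewrite leq_pmull.
Qed.

(** With [s = da] and [c = d(k-a) + e] this is the equation for [S_i(a+1) - S_i(a)]. *)
Lemma Fsum_diff i c s : (c + s)%N = K -> (0 < c)%N ->
  Fsum i (s + d) (2 * c + s)
  = Fsum i s (2 * c + s + d) + q ^+ (s * (2 * i + 1)) * Hsum i c s.
Proof.
move=> cs c0; apply/eqP; rewrite addrC -subr_eq; apply/eqP.
rewrite -sumrB mulr_sumr.
(* [g] and [h] split the difference of the terms; after [n -> n + 1] in [g], the
   products in [g] and [h] agree. *)
pose g n := (-1) ^+ n * q ^+ quad i (2 * c + s) n * (1 - q ^+ (d * n))
            * qprod (2 * i) n.
pose h n := (-1) ^+ n * q ^+ (quad i (M + s) n + s * (2 * i + 1))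
            * qprod (2 * i).+1 n.
apply: (@telescope_shift _ _
  (fun n => Fterm i (s + d) (2 * c + s) n - Fterm i s (2 * c + s + d) n)
  (fun n => q ^+ (s * (2 * i + 1)) * Hterm i c s n) g h).
- by rewrite /g muln0 subrr mulr0 mul0r.
- by rewrite /g quad_top ?mulr0 ?mul0r //; lia.
- move=> n; rewrite /g /h /Fterm qprodSr.
  have E1 : q ^+ quad i (2 * c + s + d) n = q ^+ quad i (2 * c + s) n * q ^+ (d * n).
    by rewrite -exprD; congr (_ ^+ _); rewrite /quad; ring.
  have E2 : q ^+ quad i (2 * c + s) n * q ^+ (d * n) * q ^+ (s * (2 * n + 1 + 2 * i))
     = q ^+ (quad i (M + s) n + s * (2 * i + 1)).
    by rewrite -!exprD; congr (_ ^+ _); rewrite /quad /M -cs; ring.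
  have E3 : q ^+ quad i (2 * c + s) n * q ^+ ((s + d) * (2 * n + 1 + 2 * i))
     = q ^+ (quad i (M + s) n + s * (2 * i + 1)) * q ^+ (d * (n + (2 * i).+1)).
    by rewrite -!exprD; congr (_ ^+ _); rewrite /quad /M -cs; ring.
  by ring: E1 E2 E3.
- move=> n; rewrite /g /h /Hterm qprodSl quadS exprS.
  have E1 : q ^+ (quad i (2 * c + s) n + 2 * i * K + M * n + (2 * c + s))
    = q ^+ (s * (2 * i + 1)) * q ^+ quad i (M + s) n * q ^+ (c * (2 * n + 2 * i + 2)).
    by rewrite -!exprD; congr (_ ^+ _); rewrite /quad /M -cs; ring.
  by rewrite E1 (exprD _ (quad _ _ _)); ring.
Qed.

(** With [c = db + e] and [r = d(k-b-1)] this is the equation for [T_i(b+1) - T_i(b)]; its factor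
    [[d]_y] is left to [Wprod]. *)
Lemma Hsum_diff i c r : (c + r + d)%N = K ->
  Hsum i (c + d) r
  = Hsum i c (r + d) + q ^+ ((2 * i + 2) * c) * Fsum i.+1 (r + d) (2 * c + r + 2 * d).
Proof.
move=> cs; apply/eqP; rewrite addrC -subr_eq; apply/eqP.
rewrite -sumrB mulr_sumr.
have i2 : (2 * i.+1 = (2 * i).+2)%N by lia.
(* With [x = q^(dn)] and [m = 2n+2i+2], [1 - q^((c+d)m) - x(1 - q^(cm)) = (1 - x) + x q^(cm) (1 -
   q^(d(n+2i+2)))]. *)
pose g n := (-1) ^+ n * q ^+ quad i (M + r) n * (1 - q ^+ (d * n))
            * qprod (2 * i).+1 n.
pose h n := (-1) ^+ n * q ^+ (quad i (M + (r + d)) n + c * (2 * n + 2 * i + 2))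
            * qprod (2 * i.+1) n.
apply: (@telescope_shift _ _
  (fun n => Hterm i (c + d) r n - Hterm i c (r + d) n)
  (fun n => q ^+ ((2 * i + 2) * c) * Fterm i.+1 (r + d) (2 * c + r + 2 * d) n) g h).
- by rewrite /g muln0 subrr mulr0 mul0r.
- by rewrite /g quad_top ?mulr0 ?mul0r //; rewrite /M; lia.
- move=> n; rewrite /g /h /Hterm i2 (qprodSr _.+1).
  have E1 : q ^+ quad i (M + (r + d)) n = q ^+ quad i (M + r) n * q ^+ (d * n).
    by rewrite -exprD; congr (_ ^+ _); rewrite /quad; ring.
  have E2 : q ^+ quad i (M + r) n * q ^+ ((c + d) * (2 * n + 2 * i + 2))
     = q ^+ quad i (M + r) n * q ^+ (d * n) * q ^+ (c * (2 * n + 2 * i + 2))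
       * q ^+ (d * (n + (2 * i).+2)).
    by rewrite -!exprD; congr (_ ^+ _); rewrite /quad /M -cs; ring.
  by rewrite (exprD _ (quad _ _ _)); ring: E1 E2.
- move=> n; rewrite /g /h /Fterm i2 (qprodSl _.+1) quadS exprS.
  have E1 : q ^+ (quad i (M + r) n + 2 * i * K + M * n + (M + r))
    = q ^+ ((2 * i + 2) * c) * q ^+ quad i.+1 (2 * c + r + 2 * d) n
      * q ^+ ((r + d) * (2 * n + 1 + 2 * i.+1)).
    by rewrite -!exprD; congr (_ ^+ _); rewrite /quad /M -cs; ring.
  have E2 : q ^+ (quad i (M + (r + d)) n + c * (2 * n + 2 * i + 2))
    = q ^+ ((2 * i + 2) * c) * q ^+ quad i.+1 (2 * c + r + 2 * d) n.
    by rewrite -!exprD; congr (_ ^+ _); rewrite /quad /M -cs; ring.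
  by rewrite E1 E2 i2; ring.
Qed.

(* This replaces [Hsum_diff] at the negative value [c = e - d = - e]. *)
Lemma Hsum_half i e r : (e + r)%N = K -> d = (2 * e)%N ->
  Hsum i e r * (1 + q ^+ ((2 * i + 2) * e)) = Fsum i.+1 (r + d) (2 * e + r).
Proof.
move=> cs de; rewrite mulr_suml.
have i2 : (2 * i.+1 = (2 * i).+2)%N by lia.
(* With [Y = q^((2i+2)e)] and [x = q^(dn)], [(1 - Yx)(1 + Y) = Y(1 - x) + (1 - Y^2 x)]; as [d = 2e],
   the last bracket is the last factor of [qprod (2i+2) n]. *)
pose g n := (-1) ^+ n * q ^+ quad i (M + r) n * q ^+ ((2 * i + 2) * e)
            * (1 - q ^+ (d * n)) * qprod (2 * i).+1 n.
pose h n := (-1) ^+ n * q ^+ quad i (M + r) n * qprod (2 * i.+1) n.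
apply: (@telescope_shift _ _
  (fun n => Hterm i e r n * (1 + q ^+ ((2 * i + 2) * e)))
  (fun n => Fterm i.+1 (r + d) (2 * e + r) n) g h).
- by rewrite /g muln0 subrr mulr0 mul0r.
- by rewrite /g quad_top ?mulr0 ?mul0r //; rewrite /M; lia.
- move=> n; rewrite /g /h /Hterm i2 (qprodSr _.+1).
  have E1 : q ^+ (e * (2 * n + 2 * i + 2)) = q ^+ ((2 * i + 2) * e) * q ^+ (d * n).
    by rewrite -exprD; congr (_ ^+ _); rewrite de; ring.
  have E2 : q ^+ ((2 * i + 2) * e) * q ^+ ((2 * i + 2) * e) * q ^+ (d * n)
     = q ^+ (d * (n + (2 * i).+2)).
    by rewrite -!exprD; congr (_ ^+ _); rewrite de; ring.
  by ring: E1 E2.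
- move=> n; rewrite /g /h /Fterm i2 (qprodSl _.+1) quadS exprS.
  have E1 : q ^+ (quad i (M + r) n + 2 * i * K + M * n + (M + r)) * q ^+ ((2 * i + 2) * e)
    = q ^+ quad i (M + r) n * q ^+ ((r + d) * (2 * n + 1 + 2 * i.+1)).
    by rewrite -!exprD; congr (_ ^+ _); rewrite /quad /M -cs de; ring.
  have E2 : q ^+ quad i.+1 (2 * e + r) n = q ^+ quad i (M + r) n.
    by congr (_ ^+ _); rewrite /quad /M -cs de; ring.
  by rewrite i2 in E1; ring: E1 E2.
Qed.

Lemma Hsum0 i s : Hsum i 0 s = 0.
Proof. by apply: big1 => n _; rewrite /Hterm mul0n subrr mulr0 mul0r. Qed.

Lemma Fsum0 i r : Fsum i 0 r = 0.
Proof. by apply: big1 => n _; rewrite /Fterm mul0n subrr mulr0 mul0r. Qed.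

(** The start of the downward induction on [i], in place of [S_i(a) = 1 + O(q^(2i+1))]: the
    exponents in all terms [n > 0] exceed [N]. *)
Lemma Fsum_top i s r : (0 < K)%N -> (N < i)%N -> (0 < s)%N ->
  Fsum i s r = qprod (2 * i) 0.
Proof.
move=> K_gt0 Ni s0; rewrite /Fsum big_ord_recl big1 ?addr0 => [|n _].
  rewrite /Fterm /quad !muln0 expr0 !mul1r (expr_nilM q_nil) ?subr0 ?mul1r //; lia.
rewrite /Fterm (expr_nil q_nil) ?mulr0 ?mul0r // /quad lift0; nia.
Qed.
End Difference.

(** * Multiplicity vectors *)

Section MultiplicityVectors.
Variables d K : nat.

(* Lists [[:: phi_p; ...; phi_(p+m-1)]] with [phi_p < c], consecutive sums [< K], and
   [d] dividing the entries of odd index. *)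
Fixpoint mvecs (m p c : nat) : seq (seq nat) :=
  if m is m'.+1 then
    [seq t :: v | t <- [seq t <- iota 0 c | odd p ==> (d %| t)%N],
                  v <- mvecs m' p.+1 (K - t)]
  else [:: [::]].

Fixpoint mwt (p : nat) (v : seq nat) : nat :=
  if v is t :: v' then (p * t + mwt p.+1 v')%N else 0%N.

Fixpoint mgf (R : comNzRingType) (q : R) (m p c : nat) : R :=
  if m is m'.+1 then
    \sum_(0 <= t < c | odd p ==> (d %| t)%N) q ^+ (p * t) * mgf q m' p.+1 (K - t)
  else 1.

Lemma mgfE (R : comNzRingType) (q : R) m p c :
  mgf q m p c = \sum_(v <- mvecs m p c) q ^+ mwt p v.
Proof.
elim: m p c => [|m IHm] p c /=; first by rewrite big_seq1.
rewrite big_allpairs_dep big_filter /index_iota subn0.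
apply: eq_bigr => t _; rewrite IHm mulr_sumr.
by apply: eq_bigr => v _; rewrite exprD.
Qed.

Lemma mvecs_uniq m p c : uniq (mvecs m p c).
Proof.
elim: m p c => [|m IHm] p c //=.
apply: allpairs_uniq_dep => //; first by rewrite filter_uniq ?iota_uniq.
by move=> [t v] [t' v'] _ _ /= [-> ->].
Qed.

Lemma mem_mvecs m p c v :
  v \in mvecs m p c <->
  [/\ size v = m, (0 < m)%N -> (nth 0 v 0 < c)%N,
      (forall i, (i.+1 < m)%N -> (nth 0 v i + nth 0 v i.+1 < K)%N) &
      (forall i, (i < m)%N -> odd (p + i) -> (d %| nth 0 v i)%N)].
Proof.
elim: m p c v => [|m IHm] p c v /=.
  rewrite inE; split => [/eqP -> //|[/size0nil ->]//].
split.
  case/allpairsPdep => t [w [+ /IHm + ->]].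
  rewrite mem_filter mem_iota add0n /= => /andP[/implyP pt tc] [sw w0 wK wd].
  split => //=; first by rewrite sw.
  - case=> [|i] /=; last by rewrite ltnS => /wK.
    by move=> im; rewrite -ltn_subRL; apply: w0.
  - case=> [|i] /=; first by rewrite addn0.
    by rewrite ltnS addnS => im; apply: wd.
case: v => [|t w] [] //= [sw] /(_ isT) tc wK wd.
apply/allpairsPdep; exists t, w; split=> //.
  rewrite mem_filter mem_iota add0n /= tc andbT.
  by apply/implyP => po; apply: (wd 0%N) => //; rewrite addn0.
apply/IHm; split=> //.
- by move=> m0; rewrite ltn_subRL; apply: (wK 0%N).
- by move=> i im; apply: (wK i.+1).
- by move=> i im; rewrite addSnnS; apply: (wd i.+1).
Qed.

Lemma rmorph_mgf (R S : comNzRingType) (f : {rmorphism R -> S}) (q : R) m p c :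
  f (mgf q m p c) = mgf (f q) m p c.
Proof.
by rewrite !mgfE rmorph_sum; apply: eq_bigr => v _; rewrite rmorphXn.
Qed.
End MultiplicityVectors.

(** * Recurrences for the generating functions *)

Section Recurrence.
Variables (R : comNzRingType) (q : R) (d K : nat).
Hypothesis d_gt0 : (0 < d)%N.

Definition qnat (x : R) n := \sum_(0 <= t < n) x ^+ t.

(** The only multiple of [d] from [da] to [d(a+1) - 1] is [da]. *)
Lemma mgf_oddS m p a : odd p ->
  mgf d K q m.+1 p (d * a.+1)
  = mgf d K q m.+1 p (d * a) + q ^+ (p * (d * a)) * mgf d K q m p.+1 (K - d * a).
Proof.
move=> po; rewrite /= po /=.
rewrite (big_cat_nat (n := d * a)) //=; last by rewrite leq_mul2l leqnSn orbT.
congr (_ + _).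
rewrite big_ltn_cond ?ltn_mul2l ?d_gt0 ?ltnSn //= dvdn_mulr //.
rewrite big_nat_cond big1 ?addr0 // => t /andP[/andP[t1 t2] /dvdnP[j tj]].
by have [ja|ja] := leqP j a; nia.
Qed.

Lemma mgf_odd0 m p : mgf d K q m.+1 p (d * 0) = 0.
Proof. by rewrite /= muln0 big_geq. Qed.

Lemma mgf_odd_ceil m p c a : odd p -> (d * a < c <= d * a.+1)%N ->
  mgf d K q m p c = mgf d K q m p (d * a.+1).
Proof.
case: m => // m po /andP[ac ca] /=; rewrite po /=.
rewrite [RHS](big_cat_nat (n := c)) //= [X in _ + X]big_nat_cond [X in _ + X]big1 ?addr0 //.
move=> t /andP[/andP[t1 t2] /dvdnP[j tj]].
by have [ja|ja] := leqP j a; nia.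
Qed.

(** The bounds [K - t] of the block all round up to [d(a+1)], so the tail is a common factor. The
    block [l = d] gives the step in [b], and [l = e] gives [T_i(0)]. *)
Lemma mgf_even_block m p c l a : ~~ odd p ->
  (forall t, (c <= t < c + l)%N -> (d * a < K - t <= d * a.+1)%N) ->
  mgf d K q m.+1 p (c + l)
  = mgf d K q m.+1 p c
    + q ^+ (p * c) * qnat (q ^+ p) l * mgf d K q m p.+1 (d * a.+1).
Proof.
move=> pe hc; rewrite [LHS]/= [X in _ = X + _]/= (negbTE pe).
rewrite (big_cat_nat (n := c)) ?leq_addr //=; congr (_ + _).
rewrite -{1}[c]add0n big_addn /qnat mulr_sumr mulr_suml addKn.
rewrite !big_nat; apply: eq_bigr => t /andP[_ tl].
rewrite -exprM mulnDr exprD [q ^+ (p * t) * _]mulrC; congr (_ * _).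
by apply: mgf_odd_ceil => //; apply: hc; lia.
Qed.
End Recurrence.

(** * Solution of the recurrence *)

Section Solution.
Variables (R : comNzRingType) (q : R) (N d e k : nat).
Hypothesis q_nil : q ^+ N.+1 = 0.
Hypotheses (d_gt0 : (0 < d)%N) (de : e = d \/ (2 * e)%N = d).
Let K := (d * k + e)%N.
Let M := (2 * K + d)%N.

Let e_gt0 : (0 < e)%N. Proof. by case: de; lia. Qed.
Let le_ed : (e <= d)%N. Proof. by case: de; lia. Qed.

Lemma qnatD (x : R) m n : qnat x (m + n) = qnat x m + x ^+ m * qnat x n.
Proof.
rewrite /qnat (big_cat_nat (n := m)) ?leq_addr //=; congr (_ + _).
rewrite -{1}[m]add0n big_addn addKn mulr_sumr.
by apply: eq_bigr => t _; rewrite addnC exprD.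
Qed.

(** The condition on [T_i(0)], multiplied by [[d]_y]. For [e = d] it is [Hsum_diff] at [c = 0],
    where [Hsum] vanishes; for [d = 2e] it is [Hsum_half], by [[d]_y = [e]_y (1 + y^e)]. *)
Lemma Hsum_base i :
  Hsum q N d K i e (d * k) * qnat (q ^+ (2 * i + 2)) d
  = qnat (q ^+ (2 * i + 2)) e * Fsum q N d K i.+1 (d * k.+1) (M - d * k.+1).
Proof.
rewrite (mulnSr d k).
case: de => [ed|ed].
  have Kd : (0 + d * k + d)%N = K by rewrite /K ed.
  have := Hsum_diff q_nil d_gt0 i Kd.
  rewrite Hsum0 add0r muln0 expr0 mul1r add0n -{2}ed => ->.
  have -> : (M - (d * k + d) = 2 * 0 + d * k + 2 * d)%N by rewrite /M -Kd; lia.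
  by rewrite ed mulrC.
have := @Hsum_half R q N d K q_nil d_gt0 i e (d * k).
rewrite addnC => /(_ erefl (esym ed)) H.
have -> : (M - (d * k + d) = 2 * e + d * k)%N by rewrite /M /K; lia.
have -> : qnat (q ^+ (2 * i + 2)) d = qnat (q ^+ (2 * i + 2)) (e + e).
  by rewrite addnn -mul2n ed.
by rewrite -H qnatD -exprM; ring.
Qed.

(** The product of [[d]_(q^(2l))] over [l > i], with the index shifted by one and cut at a point
    past which the factors are 1. *)
Definition Wprod i := \prod_(i <= l < N.+1) qnat (q ^+ (2 * l + 2)) d.
(** In place of [(q^d;q^d)_oo]; the length makes it the value of [Fsum] at [i = N+1]. *)
Let E := qprod q d (2 * N.+1) 0.

(** Vectors of length [2j] starting at part [2i+1] end at part [2(N+1)]. Downward induction on [i];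
    for each [i], induction on [b] and then on [a], the order in which the system determines [T_i]
    and [S_i]. *)
Lemma mgf_solution j i a : (i + j)%N = N.+1 -> (0 < a <= k.+1)%N ->
  mgf d K q (2 * j) (2 * i + 1) (d * a) * E
  = Fsum q N d K i (d * a) (M - d * a) * Wprod i.
Proof.
elim: j i a => [|j IHj] i a ij /andP[a0 ak].
  rewrite addn0 in ij; rewrite ij /Wprod big_geq // mulr1 muln0 mul1r.
  by rewrite (Fsum_top q_nil) ?muln_gt0 ?d_gt0 // addn_gt0 e_gt0 orbT.
have {}IHj a' : (0 < a' <= k.+1)%N ->
    mgf d K q (2 * j) (2 * i + 2).+1 (d * a') * E
    = Fsum q N d K i.+1 (d * a') (M - d * a') * Wprod i.+1.
  by move=> ha; rewrite -IHj //; [congr (mgf _ _ _ _ _ _ * _)|]; lia.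
have WE : Wprod i = qnat (q ^+ (2 * i + 2)) d * Wprod i.+1
  by rewrite /Wprod big_ltn //; lia.
have pe : ~~ odd (2 * i + 2) by lia.
have po : odd (2 * i + 1) by lia.
have evenP b : (b <= k)%N ->
    mgf d K q (2 * j).+1 (2 * i + 2) (d * b + e) * E
    = Hsum q N d K i (d * b + e) (d * (k - b)) * Wprod i.
  elim: b => [_|b IHb bk].
    have -> : (d * 0 + e = 0 + e)%N by rewrite muln0.
    (* For [t < e] the bound [K - t] is above [dk] and at most [dk + e <= d(k+1)]. *)
    rewrite (@mgf_even_block _ _ _ _ d_gt0 _ _ _ _ k) //; last first.
      by move=> t /andP[_ te]; rewrite mulnS /K; lia.
    rewrite [mgf d _ q _.+1 _ 0]/= big_geq // muln0 expr0 add0r mul1r.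
    rewrite -mulrA IHj ?ltnS ?leqnn // mulrA -Hsum_base WE subn0 add0n; ring.
  have -> : (d * b.+1 + e = d * b + e + d)%N by rewrite mulnS; lia.
  have [r kr] : exists r, k = (b + r.+1)%N by exists (k - b.+1)%N; lia.
  rewrite (@mgf_even_block _ _ _ _ d_gt0 _ _ _ _ r) //; last first.
    by move=> t /andP[h1 h2]; rewrite mulnS /K kr; nia.
  rewrite mulrDl IHb 1?ltnW // -mulrA IHj; last by rewrite kr; lia.
  have -> : (k - b.+1 = r)%N by rewrite kr; lia.
  rewrite (Hsum_diff q_nil) //; last by rewrite /K kr; nia.
  have -> : (k - b = r.+1)%N by rewrite kr; lia.
  have -> : (d * r.+1 = d * r + d)%N by rewrite mulnS addnC.
  have -> : (M - (d * r + d) = 2 * (d * b + e) + d * r + 2 * d)%N.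
    by rewrite /M /K kr; nia.
  rewrite WE; ring.
elim: a a0 ak => // a IHa _ ak.
have -> : (2 * j.+1 = (2 * j).+2)%N by lia.
rewrite mgf_oddS // mulrDl -mulrA.
have [r kr] : exists r, k = (a + r)%N by exists (k - a)%N; lia.
have -> : (K - d * a = d * r + e)%N by rewrite /K kr; nia.
have -> : (2 * i + 1).+1 = (2 * i + 2)%N by lia.
rewrite evenP; last by rewrite kr leq_addl.
have -> : (k - r = a)%N by rewrite kr; lia.
have -> : (d * a.+1 = d * a + d)%N by rewrite mulnS addnC.
have -> : (M - (d * a + d) = 2 * (d * r + e) + d * a)%N by rewrite /M /K kr; nia.
rewrite (Fsum_diff q_nil) //; [|by rewrite /K kr; nia|by lia].
rewrite mulrDl; congr (_ + _); last by rewrite mulrA mulnC.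
case: a IHa ak kr => [|a] IHa ak kr; first by rewrite mgf_odd0 muln0 Fsum0 !mul0r.
have -> : ((2 * j).+2 = 2 * j.+1)%N by lia.
rewrite IHa //; last by lia.
by congr (Fsum _ _ _ _ _ _ _ * _); rewrite /M /K kr; nia.
Qed.
End Solution.

(** * The triple product *)

Section QBinomial.
Variables (R : comNzRingType) (Q : R).

Definition qfact m : R := \prod_(j < m) (1 - Q ^+ j.+1).

Lemma qfactS m : qfact m.+1 = qfact m * (1 - Q ^+ m.+1).
Proof. by rewrite /qfact big_ord_recr. Qed.

(** The Gaussian binomial coefficient, by a Pascal rule that avoids division in [R]. *)
Fixpoint qbin (n l : nat) : R :=
  match n, l with
  | _, 0 => 1
  | 0, _.+1 => 0
  | n'.+1, l'.+1 => qbin n' l + Q ^+ (n' - l') * qbin n' l'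
  end.

Lemma qbin0 n : qbin n 0 = 1. Proof. by case: n. Qed.

Lemma qbin_small n l : (n < l)%N -> qbin n l = 0.
Proof.
elim: n l => [|n IHn] [|l] //= nl.
by rewrite !IHn ?mulr0 ?addr0 // ltnW.
Qed.

Lemma qbin_qfact n l : (l <= n)%N -> qbin n l * (qfact l * qfact (n - l)) = qfact n.
Proof.
elim: n l => [|n IHn] [|l] //= ln.
- by rewrite /qfact !big_ord0 !mulr1.
- by rewrite /qfact big_ord0 subn0 !mul1r.
rewrite subSS [qfact n.+1]qfactS; have [ltln|] := ltnP l n; last first.
  move=> nl; have -> : l = n by apply/eqP; rewrite eqn_leq nl -ltnS ln.
  have q0 : qfact 0 = 1 by rewrite /qfact big_ord0.
  have := IHn n (leqnn n); rewrite subnn (@qbin_small n n.+1) // q0 !mulr1 => H.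
  by rewrite expr0 add0r mul1r qfactS mulrA H.
have -> : Q ^+ n.+1 = Q ^+ (n - l) * Q ^+ l.+1.
  by rewrite -exprD; congr (_ ^+ _); lia.
have fE : qfact (n - l) = qfact (n - l.+1) * (1 - Q ^+ (n - l)).
  by rewrite -(subnSK ltln) qfactS.
transitivity (qbin n l.+1 * (qfact l.+1 * qfact (n - l.+1)) * (1 - Q ^+ (n - l))
  + Q ^+ (n - l) * (qbin n l * (qfact l * qfact (n - l))) * (1 - Q ^+ l.+1)).
  by rewrite fE qfactS; ring.
by rewrite (IHn l.+1) // (IHn l) ?(ltnW ltln) //; ring.
Qed.

(** The Pascal rule as the adjunction of one factor [1 - x]; both halves of the finite triple
    product grow in this way. *)
Lemma sum_qbinS n (x : R) (t : nat -> R) :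
  (forall l, (l <= n)%N -> - x * t l = Q ^+ (n - l) * t l.+1) ->
  \sum_(l < n.+2) qbin n.+1 l * t l = (1 - x) * \sum_(l < n.+1) qbin n l * t l.
Proof.
move=> Ht; rewrite big_ord_recl.
under eq_bigr => l _ do rewrite lift0 /= mulrDl.
rewrite big_split addrA mulrDl mul1r; congr (_ + _).
  rewrite -[X in X * _ + _](qbin0 n) /=.
  have -> : qbin n 0 * t 0%N + \sum_(l < n.+1) qbin n l.+1 * t l.+1
            = \sum_(l < n.+2) qbin n l * t l.
    by rewrite [RHS]big_ord_recl.
  by rewrite big_ord_recr /= qbin_small // mul0r addr0.
rewrite mulr_sumr; apply: eq_bigr => l _.
by rewrite [RHS]mulrCA Ht -1?ltnS // [RHS]mulrCA mulrA.
Qed.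
End QBinomial.

Section TripleProduct.
Variables (R : comNzRingType) (q : R) (N s r : nat).
Hypothesis q_nil : q ^+ N.+1 = 0.
Hypotheses (s_gt0 : (0 < s)%N) (r_gt0 : (0 < r)%N).
Let u := q ^+ s.
Let v := q ^+ r.
Let Q := q ^+ (s + r).

Lemma prod_unit (I : Type) (rI : seq I) (P : pred I) (F : I -> nat) :
  (forall i, P i -> 0 < F i)%N ->
  exists w, \prod_(i <- rI | P i) (1 - q ^+ F i) * w = 1.
Proof.
move=> F0; exists (\prod_(i <- rI | P i) ginv N (q ^+ F i)).
by rewrite -big_split big1 //= => i Pi; rewrite (mul_ginv q_nil) ?F0.
Qed.

Lemma qfact_unit m : exists w, qfact Q m * w = 1.
Proof.
rewrite /qfact; under eq_bigr do rewrite -exprM.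
by apply: prod_unit => j _; rewrite muln_gt0 addn_gt0 s_gt0.
Qed.

Lemma qfact_cancel m x y : qfact Q m * x = qfact Q m * y -> x = y.
Proof.
move=> H; have [w Hw] := qfact_unit m.
by rewrite -[x]mul1r -[y]mul1r -Hw -![_ * w * _]mulrAC H.
Qed.

Lemma qfact_trunc m : (N <= m)%N -> qfact Q m = qfact Q N.
Proof.
move=> /subnK <-; elim: (m - N)%N => // j IHj; rewrite addSn qfactS IHj.
by rewrite -exprM (expr_nilM q_nil) ?subr0 ?mulr1 //; lia.
Qed.

Lemma qbin_sym n l : (l <= n)%N -> qbin Q n (n - l) = qbin Q n l.
Proof.
move=> ln; apply: (@qfact_cancel l); apply: (@qfact_cancel (n - l)).
have := qbin_qfact Q ln; have := qbin_qfact Q (leq_subr l n).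
rewrite subKn // => H1 H2.
by transitivity (qfact Q n); [rewrite -H1|rewrite -H2]; ring.
Qed.

(** All three factorials in [qbin_qfact] have reached their limit [qfact Q N], which is
    invertible. *)
Lemma qbin_trunc n l : (N <= l)%N -> (N + l <= n)%N -> qfact Q N * qbin Q n l = 1.
Proof.
move=> Nl ln; apply: (@qfact_cancel N); rewrite mulr1.
have H : qbin Q n l * (qfact Q N * qfact Q N) = qfact Q N.
  have {1}-> : qfact Q N = qfact Q l by rewrite qfact_trunc.
  have {2}-> : qfact Q N = qfact Q n by rewrite qfact_trunc //; lia.
  have -> : qfact Q N = qfact Q (n - l) by rewrite qfact_trunc //; lia.
  by apply: qbin_qfact; lia.
by rewrite -[RHS]H; ring.
Qed.

(* [tneg p] and [tpos j] are the terms of index [-p] and [j] of the bilateral series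
   [sum_j (-1)^j u^j Q^(j(j-1)/2)], where [Q = u v]; [theta n] shifts the index by [n]. *)
Definition tneg p := (-1) ^+ p * (v ^+ p * Q ^+ 'C(p, 2)).
Definition tpos j := (-1) ^+ j * (u ^+ j * Q ^+ 'C(j, 2)).
Definition theta n l := if (l < n)%N then tneg (n - l) else tpos (l - n).

Lemma tnegS p : tneg p.+1 = - (v * Q ^+ p) * tneg p.
Proof. by rewrite /tneg binS bin1 exprD !exprS; ring. Qed.

Lemma tposS j : tpos j.+1 = - (u * Q ^+ j) * tpos j.
Proof. by rewrite /tpos binS bin1 exprD !exprS; ring. Qed.

Lemma uv : u * v = Q. Proof. by rewrite -exprD. Qed.

(** Cauchy's finite form. First [m = 0], by induction on [n] after reversing the sum; then induction
    on [m]. Position [l = n] carries the index 0. *)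
Lemma finite_triple_product m n :
  \prod_(i < m) (1 - u * Q ^+ i) * \prod_(i < n) (1 - v * Q ^+ i)
  = \sum_(l < (m + n).+1) qbin Q (m + n) l * theta n l.
Proof.
elim: m => [|m IHm].
  rewrite big_ord0 mul1r add0n [RHS](reindex_inj rev_ord_inj) /=.
  transitivity (\sum_(l < n.+1) qbin Q n l * tneg l); last first.
    apply: eq_bigr => l _; rewrite subSS qbin_sym -1?ltnS //; congr (_ * _).
    rewrite /theta; case: ltnP => [|nl]; first by rewrite subKn // -ltnS.
    have -> : l = 0 :> nat by have := ltn_ord l; lia.
    by rewrite subn0 subnn /tneg /tpos !expr0.
  elim: n => [|n IHn]; first by rewrite big_ord0 big_ord1 /= mul1r /tneg !expr0 !mulr1.
  rewrite big_ord_recr /= IHn mulrC; symmetry; apply: sum_qbinS => l ln.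
  by rewrite tnegS -{1}(subnK ln) exprD; ring.
rewrite big_ord_recr /= mulrAC IHm mulrC addSn; symmetry; apply: sum_qbinS => l ln.
rewrite /theta; case: (ltnP l n) => nl.
  have [p np] : exists p, (n - l = p.+1)%N by exists (n - l.+1)%N; lia.
  have -> : (m + n - l = m + p.+1)%N by lia.
  have E : (if (l.+1 < n)%N then tneg (n - l.+1) else tpos (l.+1 - n)) = tneg p.
    case: ltnP => h; first by congr tneg; lia.
    have -> : p = 0%N by lia.
    have -> : (l.+1 - n = 0)%N by lia.
    by rewrite /tneg /tpos !expr0.
  by rewrite E np tnegS exprD exprS -uv; ring.
rewrite ltnNge (leq_trans nl) //= subSn // tposS.
have -> : Q ^+ m = Q ^+ (m + n - l) * Q ^+ (l - n) by rewrite -exprD; congr (_ ^+ _); lia.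
ring.
Qed.

Lemma sum_trunc (f : nat -> R) B : (forall n, (N < n)%N -> f n = 0) -> (N < B)%N ->
  \sum_(n < B) f n = \sum_(n < N.+1) f n.
Proof.
move=> f0 /subnK <-; elim: (B - N.+1)%N => // j IHj.
by rewrite addSn big_ord_recr /= IHj f0 ?addr0 //; lia.
Qed.

Lemma tneg0 p : (N < p)%N -> tneg p = 0.
Proof. by move=> Np; rewrite /tneg -exprM (expr_nilM q_nil) // mul0r mulr0. Qed.

Lemma tpos0 p : (N < p)%N -> tpos p = 0.
Proof. by move=> Np; rewrite /tpos -exprM (expr_nilM q_nil) // mul0r mulr0. Qed.

(** In the finite form the central terms get the coefficient 1 by [qbin_trunc]; as [m > 2N], the
    outer ones have an index of absolute value above [N] and vanish. *)
Lemma triple_product m : (2 * N < m)%N ->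
  \prod_(i < m) (1 - u * Q ^+ i) * \prod_(i < m) (1 - v * Q ^+ i) * qfact Q N
  = \sum_(n < N.+1) (tneg n + tpos n.+1).
Proof.
move=> Nm; rewrite finite_triple_product mulr_suml.
transitivity (\sum_(l < (m + m).+1) theta m l).
  apply: eq_bigr => l _; rewrite mulrAC [X in X * _]mulrC.
  have [/andP[h1 h2]|] := boolP ((N <= l)%N && (N + l <= m + m)%N).
    by rewrite qbin_trunc // mul1r.
  move=> h; suff -> : theta m l = 0 by rewrite mulr0.
  by rewrite /theta; case: ltnP => lm; [rewrite tneg0|rewrite tpos0] => //; lia.
rewrite -addSn big_split_ord /= big_split /=; congr (_ + _).
  rewrite (reindex_inj rev_ord_inj) /= -(@sum_trunc _ m.+1) //; first last.
  - by lia.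
  - exact: tneg0.
  apply: eq_bigr => l _; rewrite subSS /theta; case: ltnP => lm.
    by rewrite subKn // -ltnS.
  have -> : l = 0 :> nat by have := ltn_ord l; lia.
  by rewrite subn0 subnn /tneg /tpos !expr0.
rewrite -(@sum_trunc (fun n => tpos n.+1) m) //; last by lia.
  apply: eq_bigr => l _; rewrite /theta ltnNge addSn ltnW ?ltnS ?leq_addr //=.
  by rewrite -addnS addKn.
by move=> n Nn; rewrite tpos0 // ltnW.
Qed.
End TripleProduct.

(** * From partitions to multiplicity vectors *)

Section Multiplicities.
Local Open Scope nat_scope.

Definition mults (m : nat) (s : seq nat) : seq nat :=
  mkseq (fun j => phi s j.+1) m.

(** At [p = 1] this inverts [mults] up to order: the parts come out increasing. *)
Fixpoint expand (p : nat) (v : seq nat) : seq nat :=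
  if v is t :: v' then nseq t p ++ expand p.+1 v' else [::].

Lemma expand_ge p v x : x \in expand p v -> p <= x.
Proof.
elim: v p => [|t v IHv] p //=; rewrite mem_cat => /orP[|/IHv]; last exact: ltnW.
by rewrite mem_nseq => /andP[_ /eqP ->].
Qed.

Lemma count_expand p v i : count_mem (p + i) (expand p v) = nth 0 v i.
Proof.
elim: v p i => [|t v IHv] p i /=; first by rewrite nth_nil.
rewrite count_cat count_nseq; case: i => [|i] /=.
  rewrite addn0 eqxx mul1n (count_memPn _) ?addn0 //.
  by apply/negP => /expand_ge; rewrite ltnn.
by rewrite addnS -addSn IHv eqn_leq [_ + _ <= _]leqNgt ltnS leq_addr andbF.
Qed.

Lemma sumn_expand p v : sumn (expand p v) = mwt p v.
Proof. by elim: v p => [|t v IHv] p //=; rewrite sumn_cat sumn_nseq IHv. Qed.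

Lemma mwt_mkseq p (f : nat -> nat) m :
  mwt p (mkseq f m) = \sum_(j < m) (p + j) * f j.
Proof.
elim: m p f => [|m IHm] p f; first by rewrite big_ord0.
rewrite big_ord_recl addn0 /mkseq /= -[1]addn0 iotaDl -map_comp.
rewrite -/(mkseq (f \o (addn 1)) m) IHm; congr (_ + _).
by apply: eq_bigr => j _; rewrite addSnnS.
Qed.

Lemma mwt_mults m s : all (fun x => 0 < x <= m) s -> mwt 1 (mults m s) = sumn s.
Proof.
rewrite mwt_mkseq; elim: s => [|x s IHs] /=; first by rewrite big1 // => j; rewrite muln0.
case/andP=> /andP[x0 xm] /IHs <-.
under eq_bigr do rewrite mulnDr; rewrite big_split /=; congr (_ + _).
have x1 : x.-1 < m by rewrite prednK.
rewrite (bigD1 (Ordinal x1)) //= add1n prednK // eqxx muln1 big1 ?addn0 // => j.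
rewrite -val_eqE /= => jx; case: eqP => [xj|_]; last by rewrite muln0.
by rewrite xj eqxx in jx.
Qed.

Lemma part_le_sumn s x : x \in s -> x <= sumn s.
Proof.
elim: s => //= y s IHs; rewrite inE => /orP[/eqP ->|/IHs]; first exact: leq_addr.
by move/leq_trans; apply; apply: leq_addl.
Qed.

Lemma partition_parts n m s : n <= m -> is_partition n s -> all (fun x => 0 < x <= m) s.
Proof.
move=> nm [_ [/allP s0 sn]]; apply/allP => x xs.
by rewrite s0 //= (leq_trans (part_le_sumn xs)) // sn.
Qed.

Lemma phi_out n m s j : n <= m -> is_partition n s -> m < j -> phi s j = 0.
Proof.
move=> nm /(partition_parts nm)/allP sm mj; apply/count_memPn/negP => /sm.
by rewrite /= [j <= m]leqNgt mj andbF.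
Qed.

Lemma mults_inj n m s s' : n <= m -> is_partition n s -> is_partition n s' ->
  mults m s = mults m s' -> s = s'.
Proof.
move=> nm ps ps' e; have [so [s0 _]] := ps; have [so' [s0' _]] := ps'.
apply: (sorted_eq (leT := geq)) => //.
- by move=> y x z /= xy yz; apply: leq_trans yz xy.
- by move=> x y; rewrite /= andbC -eqn_leq => /eqP.
apply/allP => x _ /=; apply/eqP.
case: x => [|j].
  rewrite !(count_memPn _) //; apply/negP => h.
    by have := allP s0' _ h.
  by have := allP s0 _ h.
have [jm|mj] := ltnP j m; last by rewrite -!/(phi _ _) !(@phi_out n m).
by have := congr1 (nth 0 ^~ j) e; rewrite /mults !nth_mkseq.
Qed.

Lemma size_eq_count_mvecs d K c n (L : seq (seq nat)) : 0 < K -> uniq L ->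
  (forall s : seq nat, s \in L <->
          [/\ is_partition n s,
              (forall i : nat, 1 <= i -> phi s i + phi s i.+1 < K),
              phi s 1 < c &
              (forall i : nat, d %| phi s (2 * i).+1)]) ->
  size L = count (fun v => mwt 1 v == n) (mvecs d K (2 * n.+1) 1 c).
Proof.
move=> K0 uL hL; rewrite -size_filter -(size_map (mults (2 * n.+1)) L).
(* The length [2(n+1)] covers all parts up to [n] and is the one that [mgf_solution] has at
   [i = 0]. *)
have nm : n <= 2 * n.+1 by lia.
apply/perm_size/uniq_perm.
- rewrite map_inj_in_uniq // => s s' /hL[ps _ _ _] /hL[ps' _ _ _].
  exact: mults_inj nm ps ps'.
- by rewrite filter_uniq // mvecs_uniq.
move=> v; rewrite mem_filter; apply/mapP/andP => [[s /hL[ps sK s1 sd] ->]|].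
  split; first by rewrite mwt_mults ?(partition_parts nm) //; case: ps => _ [_ ->].
  apply/mem_mvecs; split.
  - by rewrite size_mkseq.
  - by move=> _; rewrite nth_mkseq.
  - by move=> i im; rewrite !nth_mkseq ?(ltnW im) //; apply: sK.
  - move=> i im; rewrite nth_mkseq // add1n /= => /negPf oi.
    have -> : i.+1 = (2 * i./2).+1 by rewrite mul2n -{1}(odd_double_half i) oi.
    exact: sd.
case=> /eqP wv /mem_mvecs[sv v1 vK vd].
have phiE i : phi (sort geq (expand 1 v)) i.+1 = nth 0 v i.
  by rewrite /phi (permP (permEl (perm_sort _ _))) -(count_expand 1 v i) add1n.
exists (sort geq (expand 1 v)); last first.
  apply: (@eq_from_nth _ 0); rewrite ?size_mkseq // => i; rewrite sv => im.
  by rewrite nth_mkseq.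
apply/hL; split.
- split; first by apply: sort_sorted => x y; exact: leq_total.
  split; first by rewrite all_sort; apply/allP => x /expand_ge.
  by rewrite (perm_sumn (permEl (perm_sort _ _))) sumn_expand.
- case=> // j _; rewrite !phiE; have [jm|jm] := ltnP j.+1 (2 * n.+1); first exact: vK.
  (* Past the end the entry is 0; the last entry is then bounded by the condition on the pair before
     it. *)
  rewrite (@nth_default _ _ _ j.+1) ?sv // addn0.
  case: j jm => [|j] jm; first by lia.
  have [jm'|jm'] := ltnP j.+1 (2 * n.+1); last by rewrite nth_default ?sv.
  by apply: leq_ltn_trans (leq_addl _ _) (vK _ jm').
- by rewrite phiE v1.
- move=> i; rewrite phiE; have [im|im] := ltnP (2 * i) (2 * n.+1).
    by apply: vd => //; rewrite add1n /= mul2n odd_double.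
  by rewrite nth_default ?sv.
Qed.
End Multiplicities.

(** * Coefficients, truncation and assembly *)

Lemma count_coef d K m c n :
  (count (fun v => mwt 1 v == n) (mvecs d K m 1 c))%:Z
  = (mgf d K ('X : {poly int}) m 1 c)`_n.
Proof.
rewrite mgfE coef_sum; elim: (mvecs d K m 1 c) => [|v vs IHv].
  by rewrite big_nil.
by rewrite big_cons -IHv /= PoszD coefXn eq_sym; case: eqP.
Qed.

Section Truncation.
Variable n : nat.
Let h : {poly int} := 'X^(n.+1).

(** Reduction changes [p] by a multiple of [X^(n+1)], so the identity of coefficients can be checked
    in the quotient, where ['X] is nilpotent. *)
Lemma in_qpoly_coef p : (in_qpoly h p)`_n = p`_n.
Proof.
rewrite /in_qpoly /= mk_monic_Xn /= {2}(Pdiv.RingMonic.rdivp_eq (monicXn _ n.+1) p).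
by rewrite coefD coefMXn ltnSn add0r.
Qed.

Lemma in_qpolyX_nil : in_qpoly h 'X ^+ n.+1 = 0.
Proof.
rewrite -rmorphXn /=; apply: val_inj => /=.
by rewrite mk_monic_Xn /= (Pdiv.RingMonic.rmodpp (monicXn _ n.+1)).
Qed.
End Truncation.

Section Assembly.
Variables (R : comNzRingType) (f : {rmorphism {poly int} -> R}) (N : nat).
Let q := f 'X.
Hypothesis q_nil : q ^+ N.+1 = 0.

(** Factors of exponent above [N] become 1, so the length [B] is free; the triple product needs more
    than [2N] factors. *)
Lemma qpoch_trE a c B : (0 < c)%N -> (N < B)%N ->
  f (qpoch_tr N a c) = \prod_(j < B) (1 - q ^+ (a + c * j)).
Proof.
move=> c0 /subnK <-; rewrite rmorph_prod big_mkcond /= big_mkord.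
elim: (B - N.+1)%N => [|m IHm]; last first.
  rewrite addSn [RHS]big_ord_recr /= -IHm (expr_nil q_nil) ?subr0 ?mulr1 //; nia.
rewrite add0n; apply: eq_bigr => j _; case: leqP => aj.
  by rewrite rmorphB rmorph1 rmorphXn.
by rewrite (expr_nil q_nil aj) subr0.
Qed.

Lemma qpoch_inv_trE a c :
  f (qpoch_inv_tr N a c) = \prod_(j < N.+1) ginv N (q ^+ (a + c * j)).
Proof.
rewrite rmorph_prod big_mkcond /= big_mkord.
apply: eq_bigr => j _; case: leqP => aj.
  by rewrite rmorph_sum; apply: eq_bigr => i _; rewrite /= rmorphXn exprM.
rewrite (expr_nil q_nil aj) /ginv big_nat_recl // expr0 big1_seq ?addr0 // => i _.
by rewrite expr0n.
Qed.
Lemma mul_qpoch_inv_tr a c : (0 < a)%N ->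
  \prod_(j < N.+1) (1 - q ^+ (a + c * j)) * f (qpoch_inv_tr N a c) = 1.
Proof.
move=> a0; rewrite qpoch_inv_trE -big_split big1 //= => j _.
by rewrite (mul_ginv q_nil) // addn_gt0 a0.
Qed.

Lemma prod_even_odd (g : nat -> R) m :
  \prod_(l < 2 * m) g l = \prod_(l < m) g (2 * l)%N * \prod_(l < m) g (2 * l).+1.
Proof.
elim: m => [|m IHm]; first by rewrite !big_ord0 mulr1.
have -> : (2 * m.+1 = (2 * m).+2)%N by lia.
by rewrite !big_ord_recr /= IHm; ring.
Qed.

Section Evaluate.
Variables d e k a : nat.
Hypotheses (d_gt0 : (0 < d)%N) (de : e = d \/ (2 * e)%N = d).
Hypotheses (a_gt0 : (0 < a)%N) (le_ak : (a <= k)%N).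
Let K := (d * k + e)%N.
Let M := (2 * K + d)%N.

(** At [i = 0] the product [qprod] is empty, and each term splits as [tneg n + tpos (n+1)] for
    [s = da] and [r = M - da]. *)
Lemma Fsum_qpoch :
  Fsum q N d K 0 (d * a) (M - d * a)
  = f (qpoch_tr N (d * a) M) * f (qpoch_tr N (M - d * a) M) * f (qpoch_tr N M M).
Proof.
have M0 : (0 < M)%N by rewrite /M; lia.
have s0 : (0 < d * a)%N by rewrite muln_gt0 d_gt0.
have aM : (d * a < M)%N by rewrite /M /K; nia.
have r0 : (0 < M - d * a)%N by lia.
have Msr : (d * a + (M - d * a) = M)%N by lia.
rewrite !(@qpoch_trE _ _ (2 * N).+1) //; try lia.
have := triple_product q_nil s0 r0 (ltnSn (2 * N)); rewrite Msr => H.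
have -> : \prod_(j < (2 * N).+1) (1 - q ^+ (M + M * j)) = qfact (q ^+ M) N.
  have := @qfact_trunc _ _ _ _ _ q_nil s0 r0 (2 * N).+1.
  rewrite Msr => <-; last by lia.
  by apply: eq_bigr => j _; rewrite -exprM mulnS.
have pE t : \prod_(j < (2 * N).+1) (1 - q ^+ (t + M * j))
    = \prod_(j < (2 * N).+1) (1 - q ^+ t * q ^+ M ^+ j).
  by apply: eq_bigr => j _; rewrite exprD exprM.
rewrite !pE H; apply: eq_bigr => j _; rewrite /Fterm /tneg /tpos Msr.
rewrite /qprod big_ord0 mulr1 mulrBr mulr1 -!exprM -!exprD exprS mulN1r mulNr.
congr (_ * _ - _); first by congr (_ ^+ _); rewrite /quad -/M; ring.
rewrite -mulrA -exprD; congr (_ * _ ^+ _); rewrite /quad -/M binS bin1 -Msr.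
by move: (M - d * a)%N => r; rewrite !addKn; ring.
Qed.

Lemma Wprod_mul :
  Wprod q N d 0 * \prod_(l < N.+1) (1 - q ^+ (2 + 2 * l))
  = \prod_(l < N.+1) (1 - q ^+ (2 * d + 2 * d * l)).
Proof.
rewrite /Wprod big_mkord -big_split; apply: eq_bigr => l _ /=.
have -> : (2 * d + 2 * d * l = (2 + 2 * l) * d)%N by ring.
rewrite exprM [(2 * l + 2)%N]addnC /qnat big_mkord.
move: (q ^+ _) => y; have := subrX1 y d; rewrite mulrC => H.
by apply: oppr_inj; rewrite -mulrN !opprB H mulrC.
Qed.

(** The product [E] splits into odd and even multiples of [d]; by [Wprod_mul] the even ones cancel
    against [Wprod] and leave the inverse of [(q^2;q^2)_oo]. *)
Lemma mgf_eval :
  mgf d K q (2 * N.+1) 1 (d * a)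
  = f (qpoch_tr N (d * a) M) * f (qpoch_tr N (M - d * a) M) * f (qpoch_tr N M M)
    * f (qpoch_inv_tr N d (2 * d)) * f (qpoch_inv_tr N 2 2).
Proof.
rewrite -Fsum_qpoch.
have := @mgf_solution _ q N d e k q_nil d_gt0 de N.+1 0 a (add0n _).
rewrite -/K -/M a_gt0 (leqW le_ak) => /(_ isT).
set S := mgf _ _ _ _ _ _; set F := Fsum _ _ _ _ _ _ _.
have -> : qprod q d (2 * N.+1) 0 = \prod_(l < N.+1) (1 - q ^+ (d + 2 * d * l))
    * \prod_(l < N.+1) (1 - q ^+ (2 * d + 2 * d * l)).
  rewrite /qprod (prod_even_odd (fun l => 1 - q ^+ (d * (0 + l.+1)))).
  by congr (_ * _); apply: eq_bigr => l _; congr (1 - _ ^+ _); ring.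
have := Wprod_mul; have := @mul_qpoch_inv_tr d (2 * d) d_gt0.
have := @mul_qpoch_inv_tr 2 2 isT.
have [|z] := @prod_unit _ q N q_nil _ (index_enum 'I_N.+1) predT
  (fun l : 'I_N.+1 => 2 * d + 2 * d * l)%N.
  by move=> i _; lia.
set Z := \prod_(_ < _) _; set G := \prod_(_ < _) _; set A := \prod_(_ < _) _.
set W := Wprod _ _ _ _; set Gi := f (qpoch_inv_tr N 2 2); set Ai := f _.
move=> Zz GGi AAi WG SE.
transitivity (S * (A * Z) * z * Ai); last first.
  rewrite SE; transitivity (F * Ai * (W * (G * Gi)) * z); first by rewrite GGi; ring.
  transitivity (F * Ai * Gi * (Z * z)); first by rewrite -WG; ring.
  by rewrite Zz; ring.
transitivity (S * (A * Ai) * (Z * z)); last by ring.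
by rewrite Zz AAi; ring.
Qed.
End Evaluate.
End Assembly.

Theorem theorem3p1 (a k d e : nat)
  (ha : (1 <= a <= k)%N) (hd : (1 <= d <= k)%N) (he : e = d \/ (2 * e)%N = d)
  (n : nat) (L : seq (seq nat)) (huniq : uniq L)
  (hL : forall s : seq nat, s \in L <->
          [/\ is_partition n s,
              (forall i : nat, (1 <= i)%N -> (phi s i + phi s i.+1 < d * k + e)%N),
              (phi s 1 < d * a)%N &
              (forall i : nat, (d %| phi s (2 * i).+1)%N)]) :
  (size L)%:Z =
  (qpoch_tr n (d * a) (2 * d * k + 2 * e + d)
   * qpoch_tr n (2 * d * k - d * a + 2 * e + d) (2 * d * k + 2 * e + d)
   * qpoch_tr n (2 * d * k + 2 * e + d) (2 * d * k + 2 * e + d)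
   * qpoch_inv_tr n d (2 * d)
   * qpoch_inv_tr n 2 2)`_n.
Proof.
have /andP[a0 ak] := ha; have /andP[d0 _] := hd.
have K0 : (0 < d * k + e)%N by case: he; lia.
rewrite (size_eq_count_mvecs K0 huniq hL) count_coef -in_qpoly_coef -[RHS]in_qpoly_coef.
rewrite rmorph_mgf (mgf_eval (in_qpolyX_nil n) d0 he a0 ak) !rmorphM /=.
have -> : (2 * (d * k + e) + d = 2 * d * k + 2 * e + d)%N by ring.
by have -> : (2 * d * k + 2 * e + d - d * a = 2 * d * k - d * a + 2 * e + d)%N by nia.
Qed.
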